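(* Let $\tau\in\mathbb{C}$ with $\operatorname{Im}\tau>0$, let $q=e^{i\pi\tau}$, and let $\theta_{3}(\tau)=\sum_{k\in\mathbb{Z}}q^{k^{2}}=\sum_{k\in\mathbb{Z}}e^{i\pi\tau k^{2}}$. Then the series on the left-hand side below converges absolutely, and $$\sum_{m=1}^{\infty}2^{1-m}\log\theta_{3}(2^{m}\tau)=2\sum_{k=1}^{\infty}\log\bigl(1-q^{2k}\bigr)+4\sum_{k=1}^{\infty}\log\bigl(1+q^{2k}\bigr).$$
   Context: Here $\theta_{3}(2^{m}\tau)=\sum_{k\in\mathbb{Z}}e^{i\pi 2^{m}\tau k^{2}}$. The function $\theta_3$ is holomorphic and nowhere zero on the upper half-plane, and $\log\theta_{3}$ denotes the holomorphic branch on the upper half-plane that equals the real logarithm of $\theta_3(\tau)>0$ for $\tau\in i\mathbb{R}^{+}$ (the positive imaginary axis). On the right-hand side $|q|<1$ and $\log$ is the principal logarithm, which is real when $\tau\in i\mathbb{R}^{+}$. *)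

(* Defs.v *)
(* Stdlib world: Stdlib's real numbers with Coquelicot's complex numbers. *)
From Stdlib Require Import Reals ZArith.
From Coquelicot Require Import Coquelicot.

Open Scope R_scope.

Definition Cexp (z : C) : C :=
  (exp (Re z) * cos (Im z), exp (Re z) * sin (Im z)).

(* Principal argument, with values in (-PI, PI]; at [z = 0] the value is a
   meaningless default. *)
Definition Carg (z : C) : R :=
  if Rle_dec 0 (Im z) then acos (Re z / Cmod z) else - acos (Re z / Cmod z).

Definition Clog (z : C) : C := (ln (Cmod z), Carg z).

(* [is_series] with both the scalars and the values pinned to [C]; left to
   inference, Coquelicot may pick another of the module structures on [R * R]. *)
Definition is_Cseries (a : nat -> C) (l : C) : Prop :=
  @is_series C_AbsRing C_NormedModule a l.

(* Total sum operators; like [Series], they are meaningful only when the real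
   and imaginary parts converge. *)
Definition CSeries (a : nat -> C) : C :=
  (Series (fun n => Re (a n)), Series (fun n => Im (a n))).

Definition CZSeries (a : Z -> C) : C :=
  (CSeries (fun n => a (Z.of_nat n))
   + CSeries (fun n => a (- Z.of_nat (S n))%Z))%C.

Definition theta3 (tau : C) : C :=
  CZSeries (fun k : Z => Cexp (Ci * PI * tau * IZR (k * k)%Z)%C).

(* [L] is the branch of log theta3 on the upper half-plane that is real on the
   positive imaginary axis; its values elsewhere are unconstrained.  This
   determines [L] on the half-plane, which is connected. *)
Definition is_log_theta3 (L : C -> C) : Prop :=
  (forall tau : C, 0 < Im tau ->
     @ex_derive C_AbsRing C_NormedModule L tau)
  /\ (forall tau : C, 0 < Im tau -> Cexp (L tau) = theta3 tau)
  /\ (forall y : R, 0 < y -> L (Ci * y)%C = RtoC (ln (Re (theta3 (Ci * y)%C)))).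

(* Main.v *)
Require Import Defs.
From Stdlib Require Import Reals ZArith Lra Lia.
From Coquelicot Require Import Coquelicot.

Open Scope R_scope.

(* Put E(x) = sum_k log (1 - x^k) and F(x) = sum_k log (1 + x^k).  The Jacobi triple
   product at z = 1 gives theta3 = exp (P(q)) with P(q) = E(q^2) + 2 (F(q) - F(q^2)); it
   is obtained from its finite form by dominated convergence.  By continuity along a
   horizontal segment starting on the imaginary axis, log theta3 = P(q) on the whole
   half-plane.  As E(x) + F(x) = E(x^2), the function G = 2 E + 4 F satisfies
   P(x) = G(x) - G(x^2) / 2, so with x = q^2 the series sum_j 2^-j P(x^(2^j)) telescopes
   to G(x). *)

(** * Complex exponential and principal logarithm *)

(** The delicate point is the branch: a sum of principal logarithms is a logarithm of the product,
    but not automatically the prescribed one. For |x| < 1 every factor 1 - x^k or 1 + x^k lies in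
    the right half-plane, where the principal argument is an arctangent. There [Clog] is continuous,
    and it is additive on (1 - x^k)(1 + x^k) = 1 - x^(2k), which is the source of E(x) + F(x) =
    E(x^2). The coefficients of G come from a small linear system. Eliminating E(x^2) gives P(x) =
    E(x) + 3 F(x) - 2 F(x^2), while G = a E + b F gives G(x) - G(x^2) / 2 = (a/2) E(x) + (b - a/2)
    F(x) - (b/2) F(x^2); hence a = 2 and b = 4. The remainder 2^-n G(x^(2^n)) of the telescoping sum
    vanishes because G is bounded on each closed disk of radius r < 1. *)

Lemma C_eq (z w : C) : Re z = Re w -> Im z = Im w -> z = w.
Proof. destruct z, w; simpl; intros -> ->; reflexivity. Qed.

Lemma im_le_Cmod (z : C) : Rabs (Im z) <= Cmod z.
Proof. eapply Rle_trans; [|apply Rmax_Cmod]; apply Rmax_r. Qed.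

Lemma Cmod_le_re_im (z : C) : Cmod z <= Rabs (Re z) + Rabs (Im z).
Proof.
  destruct z as [a b].
  replace ((a, b) : C) with (a + b * Ci)%C
    by (apply C_eq; simpl; ring).
  eapply Rle_trans; [apply Cmod_triangle|].
  rewrite Cmod_mult, Cmod_Ci, !Cmod_R; simpl.
  replace (a + (b * 0 - 0 * 1)) with a by ring.
  replace (0 + (b * 1 + 0 * 0)) with b by ring; lra.
Qed.

Lemma Cexp_add (z w : C) : Cexp (z + w) = (Cexp z * Cexp w)%C.
Proof.
  unfold Cexp; rewrite re_plus, im_plus, exp_plus, cos_plus, sin_plus.
  apply C_eq; simpl; ring.
Qed.

Lemma Cexp_0 : Cexp 0 = 1%C.
Proof. unfold Cexp; simpl; rewrite exp_0, cos_0, sin_0; apply C_eq; simpl; ring. Qed.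

Lemma Cexp_neq_0 (z : C) : Cexp z <> 0%C.
Proof.
  intros H; assert (E : (Cexp z * Cexp (- z))%C = 1%C)
    by (rewrite <- Cexp_add; replace (z + - z)%C with (RtoC 0) by ring; apply Cexp_0).
  rewrite H, Cmult_0_l in E; injection E; lra.
Qed.

Lemma Cexp_opp (z : C) : Cexp (- z) = (/ Cexp z)%C.
Proof.
  assert (E : (Cexp z * Cexp (- z))%C = 1%C)
    by (rewrite <- Cexp_add; replace (z + - z)%C with (RtoC 0) by ring; apply Cexp_0).
  rewrite <- (Cmult_1_r (/ _)), <- E; field; apply Cexp_neq_0.
Qed.

Lemma Cexp_nat_mul (n : nat) (z : C) : Cexp (INR n * z) = (Cexp z ^ n)%C.
Proof.
  induction n as [|n IH].
  - simpl; rewrite Cmult_0_l; apply Cexp_0.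
  - rewrite Cpow_S, <- IH, <- Cexp_add, S_INR, RtoC_plus; f_equal; ring.
Qed.

Lemma Cmod_Cexp (z : C) : Cmod (Cexp z) = exp (Re z).
Proof.
  unfold Cexp, Cmod; simpl fst; simpl snd.
  pose proof (sin2_cos2 (Im z)) as H; unfold Rsqr in H.
  transitivity (sqrt (exp (Re z) ^ 2)); [f_equal; nra|].
  apply sqrt_pow2; left; apply exp_pos.
Qed.

(** Moduli give the real parts. Equal sines and cosines make the cosine of the difference of the
    imaginary parts 1, so the sine of half that difference vanishes; the zeros of the sine then
    yield the period 2 PI. *)
Lemma Cexp_eq (z w : C) : Cexp z = Cexp w ->
  Re z = Re w /\ exists k : Z, Im z = Im w + 2 * IZR k * PI.
Proof.
  intros H.
  assert (Hr : Re z = Re w) by (apply exp_inv; rewrite <- !Cmod_Cexp; congruence).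
  split; [exact Hr|].
  unfold Cexp in H; rewrite Hr in H; injection H as Hc Hs.
  pose proof (exp_pos (Re w)).
  assert (Hc' : cos (Im z) = cos (Im w)) by (eapply Rmult_eq_reg_l; [exact Hc|lra]).
  assert (Hs' : sin (Im z) = sin (Im w)) by (eapply Rmult_eq_reg_l; [exact Hs|lra]).
  assert (H1 : cos (2 * ((Im z - Im w) / 2)) = 1).
  { replace (2 * ((Im z - Im w) / 2)) with (Im z - Im w) by field.
    rewrite cos_minus, Hc', Hs'; pose proof (sin2_cos2 (Im w)); unfold Rsqr in *; lra. }
  rewrite cos_2a_sin in H1.
  assert (H0 : sin ((Im z - Im w) / 2) = 0) by nra.
  destruct (sin_eq_0_0 _ H0) as [k Hk]; exists k; lra.
Qed.

Lemma Cmod_pos_of_re (z : C) : 0 < Re z -> 0 < Cmod z.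
Proof. intros H; pose proof (re_le_Cmod z); pose proof (Rle_abs (Re z)); lra. Qed.

(** In the right half-plane the two cases of [Carg] merge into one arctangent, which is continuous,
    stays strictly between - PI / 2 and PI / 2 and is easy to estimate. *)
Lemma Carg_atan (z : C) : 0 < Re z -> Carg z = atan (Im z / Re z).
Proof.
  intros H; pose proof (Cmod_pos_of_re z H) as Hm.
  assert (E : acos (Re z / Cmod z) = atan (Rabs (Im z) / Re z)).
  { rewrite acos_atan by (apply Rdiv_lt_0_compat; lra); f_equal.
    replace (1 - (Re z / Cmod z)²) with ((Rabs (Im z) / Cmod z) ^ 2).
    - rewrite sqrt_pow2; [field; lra|].
      apply Rdiv_le_0_compat; [apply Rabs_pos|lra].
    - pose proof (Cmod2_alt z) as E; unfold Rsqr.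
      replace ((Rabs (Im z) / Cmod z) ^ 2) with (Rabs (Im z) ^ 2 / Cmod z ^ 2) by (field; lra).
      rewrite pow2_abs.
      replace (Im z ^ 2) with (Cmod z ^ 2 - Re z ^ 2) by lra; field; lra. }
  unfold Carg; rewrite E; destruct (Rle_dec 0 (Im z)) as [Hi|Hi].
  - rewrite Rabs_pos_eq; auto.
  - rewrite Rabs_left, <- atan_opp by lra; f_equal; field; lra.
Qed.

Lemma Cexp_Clog (z : C) : 0 < Re z -> Cexp (Clog z) = z.
Proof.
  intros H; pose proof (Cmod_pos_of_re z H) as Hm.
  unfold Cexp, Clog; simpl; rewrite exp_ln, Carg_atan, cos_atan, sin_atan by auto.
  replace (sqrt (1 + (Im z / Re z)²)) with (Cmod z / Re z).
  - apply C_eq; simpl; field; lra.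
  - rewrite <- (sqrt_pow2 (Cmod z / Re z)) by (apply Rdiv_le_0_compat; lra); f_equal.
    replace ((Cmod z / Re z) ^ 2) with (Cmod z ^ 2 / Re z ^ 2) by (field; lra).
    rewrite Cmod2_alt; unfold Rsqr; field; lra.
Qed.

Lemma Clog_im_bound (z : C) : 0 < Re z -> - PI / 2 < Im (Clog z) < PI / 2.
Proof. intros H; simpl; rewrite Carg_atan by auto; pose proof (atan_bound (Im z / Re z)); lra. Qed.

(* The three arguments lie in (-PI/2, PI/2), so the argument defect is a multiple
   of 2 PI of modulus less than 3 PI / 2. *)
Lemma Clog_mult (z w : C) : 0 < Re z -> 0 < Re w -> 0 < Re (z * w)%C ->
  Clog (z * w)%C = (Clog z + Clog w)%C.
Proof.
  intros Hz Hw Hzw.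
  assert (E : Cexp (Clog (z * w)%C) = Cexp (Clog z + Clog w)%C)
    by (rewrite Cexp_add, !Cexp_Clog; auto).
  destruct (Cexp_eq _ _ E) as [Hr [k Hk]]; apply C_eq; [exact Hr|].
  pose proof (Clog_im_bound _ Hz); pose proof (Clog_im_bound _ Hw);
    pose proof (Clog_im_bound _ Hzw); rewrite im_plus in *; pose proof PI_RGT_0.
  assert (k = 0%Z) as ->; [|lra].
  assert (-1 < IZR k < 1) as [H3 H4] by (split; nra).
  apply lt_IZR in H3; apply lt_IZR in H4; lia.
Qed.

Lemma re_1_plus_pos (w : C) : Cmod w < 1 -> 0 < Re (1 + w)%C.
Proof.
  intros H; rewrite re_plus, re_RtoC; pose proof (re_le_Cmod w) as H1.
  apply Rabs_le_between in H1; lra.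
Qed.

Lemma atan_le_id (x : R) : 0 <= x -> atan x <= x.
Proof.
  intros [Hx|<-]; [|rewrite atan_0; lra].
  destruct (MVT_gen atan 0 x (fun t => / (1 + t ^ 2))) as [c [_ Hc]].
  - intros t _; apply is_derive_Reals.
    apply derivable_pt_lim_atan.
  - intros t _; apply continuity_pt_filterlim, (ex_derive_continuous atan).
    eexists; apply is_derive_Reals, derivable_pt_lim_atan.
  - rewrite atan_0, !Rminus_0_r in Hc; rewrite Hc.
    rewrite <- (Rmult_1_l x) at 2; apply Rmult_le_compat_r; [lra|].
    rewrite <- Rinv_1; apply Rinv_le_contravar; nra.
Qed.

Lemma Rabs_atan_le (x : R) : Rabs (atan x) <= Rabs x.
Proof.
  destruct (Rle_dec 0 x).
  - rewrite !Rabs_pos_eq; auto using atan_le_id.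
    destruct r as [Hx|<-]; [|rewrite atan_0; lra].
    rewrite <- atan_0; left; apply atan_increasing; auto.
  - rewrite <- (Rabs_Ropp (atan x)), <- (Rabs_Ropp x), <- atan_opp.
    rewrite !Rabs_pos_eq; [apply atan_le_id; lra|lra|].
    rewrite <- atan_0; left; apply atan_increasing; lra.
Qed.

Lemma ln_le_sub_1 (x : R) : 0 < x -> ln x <= x - 1.
Proof. intros H; pose proof (exp_ineq1_le (ln x)) as E; rewrite exp_ln in E; lra. Qed.

(** The inequality ln y <= y - 1, used at |1 + w| and at its inverse, bounds the real part; the
    arctangent is at most |Im w| / Re (1 + w). Each part is at most |w| / (1 - r), whence the factor
    2. *)
Lemma Clog_1_plus_bound (r : R) (w : C) : r < 1 -> Cmod w <= r ->
  Cmod (Clog (1 + w)%C) <= 2 / (1 - r) * Cmod w.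
Proof.
  intros Hr Hw.
  pose proof (re_1_plus_pos w ltac:(lra)) as Hre.
  pose proof (Cmod_pos_of_re _ Hre) as Hm; pose proof (Cmod_ge_0 w).
  assert (Hlow : 1 - Cmod w <= Re (1 + w)%C).
  { rewrite re_plus, re_RtoC; pose proof (re_le_Cmod w) as H1.
    apply Rabs_le_between in H1; lra. }
  assert (Hi : / (1 - Cmod w) <= / (1 - r)) by (apply Rinv_le_contravar; lra).
  assert (Hq : Cmod w <= Cmod w * / (1 - r)).
  { rewrite <- (Rmult_1_r (Cmod w)) at 1; apply Rmult_le_compat_l; [lra|].
    rewrite <- Rinv_1; apply Rinv_le_contravar; lra. }
  assert (Hq' : Cmod w * / (1 - Cmod w) <= Cmod w * / (1 - r))
    by (apply Rmult_le_compat_l; lra).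
  assert (Hup : Cmod (1 + w)%C <= 1 + Cmod w)
    by (eapply Rle_trans; [apply Cmod_triangle|rewrite Cmod_1; lra]).
  assert (Hmlow : 1 - Cmod w <= Cmod (1 + w)%C)
    by (pose proof (re_le_Cmod (1 + w)%C) as H1; apply Rabs_le_between in H1; lra).
  eapply Rle_trans; [apply Cmod_le_re_im|].
  replace (2 / (1 - r) * Cmod w) with (Cmod w * / (1 - r) + Cmod w * / (1 - r))
    by (field; lra).
  apply Rplus_le_compat; simpl.
  - apply Rabs_le_between.
    pose proof (ln_le_sub_1 _ Hm).
    pose proof (ln_le_sub_1 (/ Cmod (1 + w)%C) ltac:(apply Rinv_0_lt_compat; lra)) as H2.
    rewrite ln_Rinv in H2 by lra.
    assert (/ Cmod (1 + w)%C <= / (1 - Cmod w)) by (apply Rinv_le_contravar; lra).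
    assert (/ (1 - Cmod w) - 1 = Cmod w * / (1 - Cmod w)) by (field; lra).
    lra.
  - rewrite Carg_atan by auto.
    eapply Rle_trans; [apply Rabs_atan_le|].
    eapply Rle_trans; [|exact Hq'].
    unfold Rdiv; rewrite Rabs_mult, (Rabs_pos_eq (/ _))
      by (left; apply Rinv_0_lt_compat; auto).
    apply Rmult_le_compat; [apply Rabs_pos|left; apply Rinv_0_lt_compat; auto| |
      apply Rinv_le_contravar; lra].
    rewrite im_plus; simpl (Im 1%C); rewrite Rplus_0_l; apply im_le_Cmod.
Qed.

(** * Limits and series of complex numbers *)

(** Componentwise, so that real limit lemmas apply directly, and over an arbitrary filter, so that
    one notion serves sequences ([eventually]) as well as points of the line and the plane
    ([locally]). *)
Definition Clim {T : Type} (F : (T -> Prop) -> Prop) (f : T -> C) (l : C) : Prop :=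
  filterlim (fun t => Re (f t)) F (locally (Re l)) /\
  filterlim (fun t => Im (f t)) F (locally (Im l)).

Section Clim_theory.

Context {T : Type} {F : (T -> Prop) -> Prop} {FF : ProperFilter F}.

Lemma filterlim_Rplus (f g : T -> R) (a b : R) :
  filterlim f F (locally a) -> filterlim g F (locally b) ->
  filterlim (fun t => f t + g t) F (locally (a + b)).
Proof.
  intros Hf Hg; eapply filterlim_comp_2; [exact Hf|exact Hg|].
  exact (filterlim_plus (K := R_AbsRing) (V := R_NormedModule) a b).
Qed.

Lemma filterlim_Rmult (f g : T -> R) (a b : R) :
  filterlim f F (locally a) -> filterlim g F (locally b) ->
  filterlim (fun t => f t * g t) F (locally (a * b)).
Proof.
  intros Hf Hg; eapply filterlim_comp_2; [exact Hf|exact Hg|].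
  exact (filterlim_mult (K := R_AbsRing) a b).
Qed.

Lemma filterlim_Ropp (f : T -> R) (a : R) :
  filterlim f F (locally a) -> filterlim (fun t => - f t) F (locally (- a)).
Proof.
  intros Hf; eapply filterlim_comp; [exact Hf|].
  exact (filterlim_opp (K := R_AbsRing) (V := R_NormedModule) a).
Qed.

Lemma filterlim_continuous (f : T -> R) (h : R -> R) (a : R) :
  filterlim f F (locally a) -> continuous h a ->
  filterlim (fun t => h (f t)) F (locally (h a)).
Proof. intros Hf Hh; eapply filterlim_comp; [exact Hf|exact Hh]. Qed.

Lemma Clim_ext (f g : T -> C) (l : C) : (forall t, f t = g t) -> Clim F f l -> Clim F g l.
Proof.
  intros E [H1 H2]; split.
  - apply (filterlim_ext (fun t => Re (f t))); [intros t; rewrite E; auto|exact H1].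
  - apply (filterlim_ext (fun t => Im (f t))); [intros t; rewrite E; auto|exact H2].
Qed.

Lemma Clim_ext_loc (f g : T -> C) (l : C) : F (fun t => f t = g t) -> Clim F f l -> Clim F g l.
Proof.
  intros E [H1 H2]; split.
  - apply (filterlim_ext_loc (fun t => Re (f t))); [|exact H1].
    apply (filter_imp (fun t => f t = g t)); [intros t ->; auto|exact E].
  - apply (filterlim_ext_loc (fun t => Im (f t))); [|exact H2].
    apply (filter_imp (fun t => f t = g t)); [intros t ->; auto|exact E].
Qed.

Lemma Clim_const (l : C) : Clim F (fun _ => l) l.
Proof. split; apply filterlim_const. Qed.

Lemma Clim_plus (f g : T -> C) (a b : C) :
  Clim F f a -> Clim F g b -> Clim F (fun t => f t + g t)%C (a + b)%C.
Proof.
  intros [H1 H2] [H3 H4]; split.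
  - rewrite re_plus; eapply filterlim_ext; [intros t; symmetry; apply re_plus|].
    apply filterlim_Rplus; auto.
  - rewrite im_plus; eapply filterlim_ext; [intros t; symmetry; apply im_plus|].
    apply filterlim_Rplus; auto.
Qed.

Lemma Clim_mult (f g : T -> C) (a b : C) :
  Clim F f a -> Clim F g b -> Clim F (fun t => f t * g t)%C (a * b)%C.
Proof.
  intros [H1 H2] [H3 H4]; split.
  - rewrite re_mult; eapply filterlim_ext; [intros t; symmetry; apply re_mult|].
    apply filterlim_Rplus; [|apply filterlim_Ropp]; apply filterlim_Rmult; auto.
  - rewrite im_mult; eapply filterlim_ext; [intros t; symmetry; apply im_mult|].
    apply filterlim_Rplus; apply filterlim_Rmult; auto.
Qed.

Lemma Clim_opp (f : T -> C) (a : C) : Clim F f a -> Clim F (fun t => - f t)%C (- a)%C.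
Proof. intros [H1 H2]; split; apply filterlim_Ropp; assumption. Qed.

Lemma Clim_Cexp (f : T -> C) (a : C) : Clim F f a -> Clim F (fun t => Cexp (f t)) (Cexp a).
Proof.
  intros [H1 H2]; split; simpl; apply filterlim_Rmult;
    apply filterlim_continuous; auto.
  - apply continuous_exp.
  - apply continuous_cos.
  - apply continuous_exp.
  - apply continuous_sin.
Qed.

Lemma Clim_unique (f : T -> C) (a b : C) : Clim F f a -> Clim F f b -> a = b.
Proof.
  intros [H1 H2] [H3 H4]; apply C_eq.
  - exact (filterlim_locally_unique (V := R_NormedModule) _ _ _ H1 H3).
  - exact (filterlim_locally_unique (V := R_NormedModule) _ _ _ H2 H4).
Qed.

Lemma Clim_filterlim (f : T -> C) (l : C) :
  filterlim f F (@locally C_UniformSpace l) <-> Clim F f l.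
Proof.
  split.
  - intros H; rewrite filterlim_locally in H.
    split; apply filterlim_locally; intros eps; generalize (H eps);
      apply filter_imp; intros t [h1 h2]; assumption.
  - intros [H1 H2]; rewrite filterlim_locally in H1, H2; apply filterlim_locally.
    intros eps; generalize (filter_and _ _ (H1 eps) (H2 eps)).
    apply filter_imp; intros t [h1 h2]; split; assumption.
Qed.

End Clim_theory.

(** * Finite sums and products, and their passage to series *)

Fixpoint Csum (f : nat -> C) (n : nat) : C :=
  match n with O => 0%C | S n => (Csum f n + f n)%C end.

Fixpoint Cprod (f : nat -> C) (n : nat) : C :=
  match n with O => 1%C | S n => (Cprod f n * f n)%C end.

Lemma Csum_ext (f g : nat -> C) (n : nat) :
  (forall k, (k < n)%nat -> f k = g k) -> Csum f n = Csum g n.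
Proof. induction n as [|n IH]; intros H; simpl; [|rewrite IH, H]; auto. Qed.

Lemma Csum_plus (f g : nat -> C) (n : nat) :
  Csum (fun k => f k + g k)%C n = (Csum f n + Csum g n)%C.
Proof. induction n as [|n IH]; simpl; [|rewrite IH]; ring. Qed.

Lemma Csum_scal (c : C) (f : nat -> C) (n : nat) :
  Csum (fun k => c * f k)%C n = (c * Csum f n)%C.
Proof. induction n as [|n IH]; simpl; [|rewrite IH]; ring. Qed.

Lemma Csum_add (f : nat -> C) (a b : nat) :
  Csum f (a + b) = (Csum f a + Csum (fun k => f (a + k)%nat) b)%C.
Proof.
  induction b as [|b IH]; [rewrite Nat.add_0_r; simpl; ring|].
  rewrite Nat.add_succ_r; simpl; rewrite IH; ring.
Qed.

Lemma Csum_head (f : nat -> C) (n : nat) :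
  Csum f (S n) = (f 0%nat + Csum (fun k => f (S k)) n)%C.
Proof. change (S n) with (1 + n)%nat; rewrite Csum_add; simpl; ring. Qed.

Lemma Csum_rev (f : nat -> C) (n : nat) :
  Csum f n = Csum (fun k => f (n - 1 - k)%nat) n.
Proof.
  induction n as [|n IH]; [reflexivity|].
  rewrite (Csum_head (fun k => f (S n - 1 - k)%nat)).
  cbn [Csum]; rewrite IH, Cplus_comm; f_equal; [f_equal; lia|].
  apply Csum_ext; intros k Hk; f_equal; lia.
Qed.

Lemma Cprod_ext (f g : nat -> C) (n : nat) :
  (forall k, f k = g k) -> Cprod f n = Cprod g n.
Proof. intros H; induction n as [|n IH]; simpl; [|rewrite IH, H]; auto. Qed.

Lemma Cexp_Csum (f : nat -> C) (n : nat) : Cexp (Csum f n) = Cprod (fun k => Cexp (f k)) n.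
Proof. induction n as [|n IH]; simpl; [apply Cexp_0|rewrite Cexp_add, IH; auto]. Qed.

Lemma sum_n_Csum (f : nat -> C) (n : nat) :
  @sum_n C_AbelianMonoid f n = Csum f (S n).
Proof.
  induction n as [|n IH]; [rewrite sum_O; symmetry; apply Cplus_0_l|].
  rewrite sum_Sn, IH; reflexivity.
Qed.

Lemma Re_Csum (f : nat -> C) (n : nat) : Re (Csum f (S n)) = sum_n (fun k => Re (f k)) n.
Proof.
  induction n as [|n IH]; [rewrite sum_O; cbn [Csum]; rewrite Cplus_0_l; reflexivity|].
  rewrite sum_Sn, <- IH; reflexivity.
Qed.

Lemma Im_Csum (f : nat -> C) (n : nat) : Im (Csum f (S n)) = sum_n (fun k => Im (f k)) n.
Proof.
  induction n as [|n IH]; [rewrite sum_O; cbn [Csum]; rewrite Cplus_0_l; reflexivity|].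
  rewrite sum_Sn, <- IH; reflexivity.
Qed.

Lemma is_Cseries_Clim_S (a : nat -> C) (l : C) :
  is_Cseries a l <-> Clim eventually (fun n => Csum a (S n)) l.
Proof.
  rewrite <- Clim_filterlim; unfold is_Cseries, is_series.
  split; apply filterlim_ext; intros n; [|symmetry]; apply sum_n_Csum.
Qed.

Lemma Clim_shift (u : nat -> C) (l : C) :
  Clim eventually (fun n => u (S n)) l <-> Clim eventually u l.
Proof.
  unfold Clim; split; intros [H1 H2]; split;
    [apply (is_lim_seq_incr_1 (fun n => Re (u n)) (Re l))
    |apply (is_lim_seq_incr_1 (fun n => Im (u n)) (Im l))
    |apply (is_lim_seq_incr_1 (fun n => Re (u n)) (Re l))
    |apply (is_lim_seq_incr_1 (fun n => Im (u n)) (Im l))]; assumption.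
Qed.

Lemma is_Cseries_Clim (a : nat -> C) (l : C) :
  is_Cseries a l <-> Clim eventually (Csum a) l.
Proof. rewrite is_Cseries_Clim_S; apply (Clim_shift (Csum a)). Qed.

Lemma is_Cseries_re_im (a : nat -> C) (l : C) :
  is_Cseries a l <->
  is_series (fun n => Re (a n)) (Re l) /\ is_series (fun n => Im (a n)) (Im l).
Proof.
  rewrite is_Cseries_Clim_S; unfold Clim, is_series.
  split; intros [H1 H2]; split; revert H1 H2.
  - intros H _; revert H; apply filterlim_ext; intros n; apply Re_Csum.
  - intros _; apply filterlim_ext; intros n; apply Im_Csum.
  - intros H _; revert H; apply filterlim_ext; intros n; symmetry; apply Re_Csum.
  - intros _; apply filterlim_ext; intros n; symmetry; apply Im_Csum.
Qed.

Lemma is_Cseries_ext (a b : nat -> C) (l : C) :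
  (forall n, a n = b n) -> is_Cseries a l -> is_Cseries b l.
Proof. intros E; apply is_series_ext; exact E. Qed.

Lemma is_Cseries_unique (a : nat -> C) (l : C) : is_Cseries a l -> CSeries a = l.
Proof.
  rewrite is_Cseries_re_im; intros [H1 H2].
  apply C_eq; simpl; apply is_series_unique; assumption.
Qed.

Lemma is_Cseries_plus (a b : nat -> C) (A B : C) :
  is_Cseries a A -> is_Cseries b B -> is_Cseries (fun n => a n + b n)%C (A + B)%C.
Proof. exact (is_series_plus a b A B). Qed.

Lemma CSeries_correct (a : nat -> C) (g : nat -> R) :
  ex_series g -> (forall n, Cmod (a n) <= g n) -> is_Cseries a (CSeries a).
Proof.
  intros Hg Ha; rewrite is_Cseries_re_im; split; simpl; apply Series_correct;
    apply (ex_series_le (K := R_AbsRing) (V := R_CompleteNormedModule) _ g); auto; intros n;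
    (eapply Rle_trans; [|apply Ha]); [apply re_le_Cmod|apply im_le_Cmod].
Qed.

(** * Domination of series and Tannery's theorem *)

Lemma sum_n_dominated (a g : nat -> R) (K n : nat) :
  (forall k, Rabs (a k) <= g k) ->
  Rabs (sum_n a (n + K) - sum_n a K) <= sum_n g (n + K) - sum_n g K.
Proof.
  intros H; induction n as [|n IH]; simpl; [rewrite !Rminus_diag, Rabs_R0; lra|].
  rewrite !sum_Sn; unfold plus; simpl.
  pose proof (H (S (n + K))).
  replace (sum_n a (n + K) + a (S (n + K)) - sum_n a K)
    with ((sum_n a (n + K) - sum_n a K) + a (S (n + K))) by ring.
  eapply Rle_trans; [apply Rabs_triang|lra].
Qed.

Lemma series_tail_dominated (a g : nat -> R) (A G : R) (K : nat) :
  (forall k, Rabs (a k) <= g k) -> is_series a A -> is_series g G ->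
  Rabs (A - sum_n a K) <= G - sum_n g K.
Proof.
  intros H Ha Hg.
  assert (L : forall u l, is_series u l ->
    is_lim_seq (fun n => sum_n u (n + K) - sum_n u K) (l - sum_n u K)).
  { intros u l Hu; apply is_lim_seq_minus'; [|apply is_lim_seq_const].
    apply (is_lim_seq_incr_n (sum_n u) K); exact Hu. }
  refine (is_lim_seq_le (fun n => Rabs (sum_n a (n + K) - sum_n a K))
    (fun n => sum_n g (n + K) - sum_n g K) (Rabs (A - sum_n a K)) (G - sum_n g K) _ _ _).
  - intros n; apply sum_n_dominated; auto.
  - exact (is_lim_seq_abs _ _ (L a A Ha)).
  - exact (L g G Hg).
Qed.

Lemma series_dominated_bound (a g : nat -> R) (A G : R) :
  (forall k, Rabs (a k) <= g k) -> is_series a A -> is_series g G -> Rabs A <= G.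
Proof.
  intros H Ha Hg; pose proof (series_tail_dominated a g A G 0 H Ha Hg) as E.
  rewrite !sum_O in E; pose proof (H 0%nat).
  replace A with ((A - a 0%nat) + a 0%nat) by ring.
  eapply Rle_trans; [apply Rabs_triang|lra].
Qed.

(** The factor 2 comes from bounding the real and imaginary parts separately. *)
Lemma Cseries_dominated_bound (a : nat -> C) (g : nat -> R) (A : C) (G : R) :
  (forall k, Cmod (a k) <= g k) -> is_Cseries a A -> is_series g G -> Cmod A <= 2 * G.
Proof.
  rewrite is_Cseries_re_im; intros H [H1 H2] Hg.
  eapply Rle_trans; [apply Cmod_le_re_im|].
  assert (Rabs (Re A) <= G).
  { eapply series_dominated_bound; [|exact H1|exact Hg].
    intros k; eapply Rle_trans; [apply re_le_Cmod|apply H]. }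
  assert (Rabs (Im A) <= G).
  { eapply series_dominated_bound; [|exact H2|exact Hg].
    intros k; eapply Rle_trans; [apply im_le_Cmod|apply H]. }
  lra.
Qed.

Lemma Tannery {T : Type} {F : (T -> Prop) -> Prop} {FF : ProperFilter F}
    (f : T -> nat -> R) (l : nat -> R) (g : nat -> R) (s : T -> R) (L : R) :
  ex_series g -> (forall t k, Rabs (f t k) <= g k) -> (forall k, Rabs (l k) <= g k) ->
  (forall k, filterlim (fun t => f t k) F (locally (l k))) ->
  (forall t, is_series (f t) (s t)) -> is_series l L -> filterlim s F (locally L).
Proof.
  intros [G HG] Hf Hlg Hl Hs HL.
  assert (Hsum : forall K, filterlim (fun t => sum_n (f t) K) F (locally (sum_n l K))).
  { induction K as [|K IH].
    - rewrite sum_O; apply (filterlim_ext (fun t => f t 0%nat)); auto.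
      intros t; rewrite sum_O; auto.
    - rewrite sum_Sn; apply (filterlim_ext (fun t => sum_n (f t) K + f t (S K))).
      + intros t; rewrite sum_Sn; auto.
      + apply filterlim_Rplus; auto. }
  apply filterlim_locally; intros eps.
  (* Three errors of at most eps / 4 add up: the tails of the series at t and of the limit series,
     both controlled by the tail of [g] beyond K, and the difference of the two partial sums. *)
  assert (He : 0 < eps / 4) by (destruct eps; simpl; lra).
  destruct (proj1 (filterlim_locally (F := eventually) (sum_n g) G) HG (mkposreal _ He)) as [K HK].
  specialize (HK K (Nat.le_refl K)); unfold ball in HK; simpl in HK.
  unfold AbsRing_ball, abs, minus, plus, opp in HK; simpl in HK.
  apply Rabs_lt_between in HK.
  generalize (proj1 (filterlim_locally (fun t => sum_n (f t) K) (sum_n l K)) (Hsum K)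
    (mkposreal _ He)).
  apply filter_imp; intros t Ht; unfold ball in *; simpl in *.
  unfold AbsRing_ball, abs, minus, plus, opp in *; simpl in *.
  pose proof (series_tail_dominated _ _ _ _ K (Hf t) (Hs t) HG) as T1.
  pose proof (series_tail_dominated _ _ _ _ K Hlg HL HG) as T2.
  apply Rabs_lt_between in Ht; apply Rabs_le_between in T1, T2.
  apply Rabs_lt_between; destruct eps as [e pe]; simpl in *; lra.
Qed.

Lemma CTannery {T : Type} {F : (T -> Prop) -> Prop} {FF : ProperFilter F}
    (f : T -> nat -> C) (l : nat -> C) (g : nat -> R) (s : T -> C) (L : C) :
  ex_series g -> (forall t k, Cmod (f t k) <= g k) -> (forall k, Cmod (l k) <= g k) ->
  (forall k, Clim F (fun t => f t k) (l k)) ->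
  (forall t, is_Cseries (f t) (s t)) -> is_Cseries l L -> Clim F s L.
Proof.
  intros Hg Hf Hl Hlim Hs HL; rewrite is_Cseries_re_im in HL; split.
  - apply (Tannery (fun t k => Re (f t k)) (fun k => Re (l k)) g); auto.
    + intros t k; eapply Rle_trans; [apply re_le_Cmod|auto].
    + intros k; eapply Rle_trans; [apply re_le_Cmod|auto].
    + intros k; apply Hlim.
    + intros t; specialize (Hs t); rewrite is_Cseries_re_im in Hs; apply Hs.
    + apply HL.
  - apply (Tannery (fun t k => Im (f t k)) (fun k => Im (l k)) g); auto.
    + intros t k; eapply Rle_trans; [apply im_le_Cmod|auto].
    + intros k; eapply Rle_trans; [apply im_le_Cmod|auto].
    + intros k; apply Hlim.
    + intros t; specialize (Hs t); rewrite is_Cseries_re_im in Hs; apply Hs.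
    + apply HL.
Qed.

(** Lets finite sums, padded with zeros, enter dominated convergence as series. *)
Lemma is_Cseries_finite (f : nat -> C) (n : nat) :
  (forall k, (n <= k)%nat -> f k = 0%C) -> is_Cseries f (Csum f n).
Proof.
  intros H; rewrite is_Cseries_Clim.
  apply (Clim_ext_loc (fun _ => Csum f n)); [|apply Clim_const].
  exists n; intros m Hm; replace m with (n + (m - n))%nat by lia.
  induction (m - n)%nat as [|d IH]; [f_equal; lia|].
  rewrite Nat.add_succ_r; simpl; rewrite <- IH, H by lia; ring.
Qed.

(** * The finite triple product *)

Definition qpoch (x : C) (n : nat) : C := Cprod (fun i => 1 - x ^ S i)%C n.

(** The Gaussian binomial coefficient. The value 0 beyond the end of a row keeps both Pascal rules
    valid at k = n. *)
Definition qbinom (x : C) (n k : nat) : C :=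
  if (k <=? n)%nat then (qpoch x n / (qpoch x k * qpoch x (n - k)))%C else 0%C.

Lemma Cmod_pow_lt_1 (x : C) (n : nat) : Cmod x < 1 -> Cmod (x ^ S n)%C < 1.
Proof.
  intros H; rewrite Cmod_pow.
  apply pow_lt_1_compat; [split; [apply Cmod_ge_0|auto]|lia].
Qed.

Lemma one_minus_pow_neq_0 (x : C) (n : nat) : Cmod x < 1 -> (1 - x ^ S n)%C <> 0%C.
Proof.
  intros H E; pose proof (Cmod_pow_lt_1 x n H) as H1.
  replace (x ^ S n)%C with (1 - (1 - x ^ S n))%C in H1 by ring.
  rewrite E in H1; replace (1 - 0)%C with (RtoC 1) in H1 by ring; rewrite Cmod_1 in H1; lra.
Qed.

Lemma qpoch_neq_0 (x : C) (n : nat) : Cmod x < 1 -> qpoch x n <> 0%C.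
Proof.
  intros H; induction n as [|n IH]; unfold qpoch in *; cbn [Cprod].
  - intros E; injection E; lra.
  - apply Cmult_neq_0; auto using one_minus_pow_neq_0.
Qed.

Lemma qbinom_n_0 (x : C) (n : nat) : Cmod x < 1 -> qbinom x n 0 = 1%C.
Proof.
  intros H; unfold qbinom; simpl Nat.leb; rewrite Nat.sub_0_r; cbn iota.
  change (qpoch x 0) with (RtoC 1); field; apply qpoch_neq_0; auto.
Qed.

Lemma qbinom_n_n (x : C) (n : nat) : Cmod x < 1 -> qbinom x n n = 1%C.
Proof.
  intros H; unfold qbinom; rewrite Nat.leb_refl, Nat.sub_diag.
  change (qpoch x 0) with (RtoC 1); field; apply qpoch_neq_0; auto.
Qed.

Lemma qbinom_gt (x : C) (n k : nat) : (n < k)%nat -> qbinom x n k = 0%C.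
Proof. intros H; unfold qbinom; destruct (Nat.leb_spec k n); [lia|auto]. Qed.

(** With v = x^(k+1) and u = x^(n-k), removal of the common factor leaves 1 - u v = (1 - v) + v (1 -
    u) = u (1 - v) + (1 - u). In the finite triple product the second rule serves when n grows, the
    first when m grows. *)
Lemma qbinom_pascal (x : C) (n k : nat) : Cmod x < 1 -> (k <= n)%nat ->
  qbinom x (S n) (S k) = (qbinom x n k + x ^ S k * qbinom x n (S k))%C /\
  qbinom x (S n) (S k) = (x ^ (n - k) * qbinom x n k + qbinom x n (S k))%C.
Proof.
  intros H Hk; destruct (Nat.eq_dec k n) as [->|Hne].
  - rewrite !qbinom_n_n, qbinom_gt, Nat.sub_diag by (auto; lia); split; simpl; ring.
  - assert (exists d, n = (k + S d)%nat) as [d ->] by (exists (n - k - 1)%nat; lia).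
    unfold qbinom; rewrite !(proj2 (Nat.leb_le _ _)) by lia.
    replace (S (k + S d) - S k)%nat with (S d) by lia.
    replace (k + S d - k)%nat with (S d) by lia.
    replace (k + S d - S k)%nat with d by lia.
    pose proof (qpoch_neq_0 x k H); pose proof (qpoch_neq_0 x d H).
    pose proof (one_minus_pow_neq_0 x k H); pose proof (one_minus_pow_neq_0 x d H).
    replace (qpoch x (S (k + S d)))
      with (qpoch x (k + S d) * (1 - x ^ S k * x ^ S d))%C
      by (rewrite <- Cpow_add_r, Nat.add_succ_l; reflexivity).
    change (qpoch x (S k)) with (qpoch x k * (1 - x ^ S k))%C.
    change (qpoch x (S d)) with (qpoch x d * (1 - x ^ S d))%C.
    generalize dependent (x ^ S k)%C; generalize dependent (x ^ S d)%C; intros u Hu v Hv.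
    split; field; auto.
Qed.

(** One of the two truncated differences is always 0, so this is |a - b| and exponents stay in
    [nat]. *)
Definition absdiff (a b : nat) : nat := (a - b + (b - a))%nat.

Lemma Csum_pascal (u v w : nat -> C) (n : nat) :
  u 0%nat = v 0%nat -> v (S n) = 0%C ->
  (forall k, (k <= n)%nat -> u (S k) = (v (S k) + w k)%C) ->
  Csum u (S (S n)) = (Csum v (S n) + Csum w (S n))%C.
Proof.
  intros H0 Hn HS; rewrite Csum_head, (Csum_ext _ (fun k => v (S k) + w k)%C)
    by (intros k Hk; apply HS; lia).
  rewrite Csum_plus, H0, Cplus_assoc, <- Csum_head.
  change (Csum v (S (S n))) with (Csum v (S n) + v (S n))%C; rewrite Hn; ring.
Qed.

(* The q-binomial theorem at a half-integral power of q; for [n = m] this is the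
   finite form of the Jacobi triple product at z = 1. *)
Lemma finite_triple_product (q : C) (n m : nat) : Cmod q < 1 ->
  (Cprod (fun i => 1 + q ^ (2 * i + 1)) n * Cprod (fun i => 1 + q ^ (2 * i + 1)) m)%C
  = Csum (fun j => qbinom (q ^ 2) (n + m) j * q ^ (absdiff j m * absdiff j m))%C (S (n + m)).
Proof.
  intros Hq; pose proof (Cmod_pow_lt_1 q 1 Hq) as Hq2.
  induction m as [|m IHm].
  - rewrite Nat.add_0_r; cbn [Cprod]; induction n as [|n IHn].
    + cbn [Cprod Csum]; rewrite qbinom_n_0 by auto; simpl; ring.
    + rewrite (Csum_pascal _
        (fun j => qbinom (q ^ 2) n j * q ^ (absdiff j 0 * absdiff j 0))%C
        (fun j => q ^ (2 * n + 1) *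
           (qbinom (q ^ 2) n j * q ^ (absdiff j 0 * absdiff j 0)))%C).
      * rewrite Csum_scal, <- IHn; cbn [Cprod]; ring.
      * rewrite !qbinom_n_0; auto.
      * rewrite qbinom_gt by lia; ring.
      (* With base q^2 the exponents match through 2 (n - k) + (k + 1)^2 = (2 n + 1) + k^2. *)
      * intros k Hk; rewrite (proj2 (qbinom_pascal _ _ _ Hq2 Hk)).
        rewrite Cmult_plus_distr_r, Cplus_comm; f_equal.
        rewrite <- Cpow_mult_r, <- !Cmult_assoc, !(Cmult_comm (qbinom _ _ _)), !Cmult_assoc.
        rewrite <- !Cpow_add_r; do 2 f_equal; unfold absdiff; nia.
  (* Raising m moves the centre of the squares one step to the right. Now the shifted term keeps its
     exponent and the unshifted one gains q^(2m+1): 2 (k + 1) + (k - m)^2 = (2 m + 1) + (k + 1 -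
     m)^2. *)
  - rewrite Nat.add_succ_r; rewrite (Csum_pascal _
        (fun j => q ^ (2 * m + 1) *
           (qbinom (q ^ 2) (n + m) j * q ^ (absdiff j m * absdiff j m)))%C
        (fun j => qbinom (q ^ 2) (n + m) j * q ^ (absdiff j m * absdiff j m))%C).
    + rewrite Csum_scal, <- IHm; cbn [Cprod]; ring.
    + rewrite !qbinom_n_0 by auto; rewrite !Cmult_1_l, <- Cpow_add_r.
      f_equal; unfold absdiff; nia.
    + rewrite qbinom_gt by lia; ring.
    + intros k Hk; rewrite (proj1 (qbinom_pascal _ _ _ Hq2 Hk)).
      rewrite Cmult_plus_distr_r, Cplus_comm; f_equal.
      rewrite <- Cpow_mult_r, <- !Cmult_assoc, !(Cmult_comm (qbinom _ _ _)), !Cmult_assoc.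
      rewrite <- !Cpow_add_r; do 2 f_equal; unfold absdiff.
      destruct (Nat.le_gt_cases (S k) m) as [h|h].
      * assert (exists d, m = (S k + d)%nat) as [d ->] by (exists (m - S k)%nat; lia).
        replace (S k - S (S k + d))%nat with 0%nat by lia.
        replace (S (S k + d) - S k)%nat with (S d) by lia.
        replace (S k - (S k + d))%nat with 0%nat by lia.
        replace (S k + d - S k)%nat with d by lia; lia.
      * assert (exists d, k = (m + d)%nat) as [d ->] by (exists (k - m)%nat; lia).
        replace (S (m + d) - S m)%nat with d by lia.
        replace (S m - S (m + d))%nat with 0%nat by lia.
        replace (S (m + d) - m)%nat with (S d) by lia.
        replace (m - S (m + d))%nat with 0%nat by lia; lia.
Qed.

(* For [k > n] the truncated [n - k] is 0: a junk value, but one that still obeys the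
   uniform bound needed for dominated convergence. *)
Definition central_qbinom (x : C) (n k : nat) : C :=
  (qpoch x (2 * n) / (qpoch x (n + k) * qpoch x (n - k)))%C.

(** Indices are counted from the centre j = n of row 2 n, and the left half is reversed. The
    resulting two sums mirror the halves k >= 0 and k < 0 of [CZSeries]. *)
Lemma finite_triple_product_sym (q : C) (n : nat) : Cmod q < 1 ->
  (Cprod (fun i => 1 + q ^ (2 * i + 1)) n * Cprod (fun i => 1 + q ^ (2 * i + 1)) n)%C
  = (Csum (fun k => central_qbinom (q ^ 2) n k * q ^ (k * k)) (S n)
     + Csum (fun k => central_qbinom (q ^ 2) n (S k) * q ^ (S k * S k)) n)%C.
Proof.
  intros Hq; rewrite finite_triple_product by auto.
  replace (S (n + n)) with (n + S n)%nat by lia; rewrite Csum_add, Cplus_comm; f_equal.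
  - apply Csum_ext; intros k Hk; unfold qbinom, central_qbinom, absdiff.
    rewrite (proj2 (Nat.leb_le _ _)) by lia.
    replace (n + n)%nat with (2 * n)%nat by lia.
    replace (2 * n - (n + k))%nat with (n - k)%nat by lia.
    replace (n + k - n + (n - (n + k)))%nat with k by lia; reflexivity.
  - rewrite Csum_rev; apply Csum_ext; intros k Hk; unfold qbinom, central_qbinom, absdiff.
    rewrite (proj2 (Nat.leb_le _ _)) by lia.
    replace (n + n - (n - 1 - k))%nat with (n + S k)%nat by lia.
    replace (n - 1 - k - n + (n - (n - 1 - k)))%nat with (S k) by lia.
    replace (n + n)%nat with (2 * n)%nat by lia.
    replace (n - 1 - k)%nat with (n - S k)%nat by lia.
    rewrite (Cmult_comm (qpoch _ (n - S k))); reflexivity.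
Qed.

(** * Logarithms of infinite products *)

(** For s = -1 and s = 1 these are the E and F of the overview; the twist s lets one set of
    estimates cover both. *)
Definition logsum (s x : C) : C := CSeries (fun k => Clog (1 + s * x ^ S k)%C).

Lemma Cmod_twisted_pow_le (r : R) (s x : C) (k : nat) : Cmod s <= 1 -> Cmod x <= r ->
  Cmod (s * x ^ S k)%C <= r ^ S k.
Proof.
  intros Hs Hx; pose proof (Cmod_ge_0 s); pose proof (Cmod_ge_0 x).
  rewrite Cmod_mult, Cmod_pow, <- (Rmult_1_l (r ^ S k)).
  apply Rmult_le_compat; auto; [apply pow_le; auto|apply pow_incr; lra].
Qed.

Lemma Clog_term_bound (r : R) (s x : C) (k : nat) : Cmod s <= 1 -> Cmod x <= r -> r < 1 ->
  Cmod (Clog (1 + s * x ^ S k)%C) <= 2 / (1 - r) * r ^ k.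
Proof.
  intros Hs Hx Hr; pose proof (Cmod_ge_0 x).
  pose proof (Cmod_twisted_pow_le r s x k Hs Hx) as Hp.
  assert (Hk : r ^ S k <= r ^ k) by
    (simpl; rewrite <- (Rmult_1_l (r ^ k)) at 2; apply Rmult_le_compat_r;
     [apply pow_le|]; lra).
  assert (Hk' : r ^ S k <= r).
  { simpl; rewrite <- (Rmult_1_r r) at 3; apply Rmult_le_compat_l; [lra|].
    rewrite <- (pow1 k); apply pow_incr; lra. }
  eapply Rle_trans; [apply (Clog_1_plus_bound r); lra|].
  apply Rmult_le_compat_l; [|lra].
  apply Rdiv_le_0_compat; lra.
Qed.

Lemma is_series_scaled_geom (c r : R) : 0 <= r < 1 ->
  is_series (fun k => c * r ^ k) (c * / (1 - r)).
Proof.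
  intros H; apply (is_series_scal (K := R_AbsRing) c (pow r)).
  apply is_series_geom; rewrite Rabs_pos_eq; lra.
Qed.

Section logsum_disk.

Context (r : R) (s x : C) (Hs : Cmod s <= 1) (Hx : Cmod x <= r) (Hr : r < 1).

Let Hr01 : 0 <= r < 1.
Proof. pose proof (Cmod_ge_0 x); lra. Qed.

Lemma is_Cseries_logsum : is_Cseries (fun k => Clog (1 + s * x ^ S k)%C) (logsum s x).
Proof.
  apply (CSeries_correct _ (fun k => 2 / (1 - r) * r ^ k)).
  - eexists; apply is_series_scaled_geom; exact Hr01.
  - intros k; apply Clog_term_bound; auto.
Qed.

Lemma logsum_bound : Cmod (logsum s x) <= 2 * (2 / (1 - r) * / (1 - r)).
Proof.
  eapply Cseries_dominated_bound; [|apply is_Cseries_logsum|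
    apply (is_series_scaled_geom _ _ Hr01)].
  intros k; apply Clog_term_bound; auto.
Qed.

(** Padding with zeros turns the partial sum into a series with the same geometric majorant, so the
    bound does not depend on n. *)
Lemma Csum_Clog_bound (n : nat) :
  Cmod (Csum (fun k => Clog (1 + s * x ^ S k)%C) n) <= 2 * (2 / (1 - r) * / (1 - r)).
Proof.
  set (f := fun k => Clog (1 + s * x ^ S k)%C).
  pose (h := fun k => if (k <? n)%nat then f k else 0%C).
  rewrite (Csum_ext f h) by
    (intros k Hk; unfold h; destruct (Nat.ltb_spec k n); [auto|lia]).
  eapply Cseries_dominated_bound; [|apply (is_Cseries_finite h n)|
    apply (is_series_scaled_geom _ _ Hr01)].
  - intros k; unfold h; destruct (k <? n)%nat; [apply Clog_term_bound; auto|].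
    rewrite Cmod_0; apply Rmult_le_pos; [apply Rdiv_le_0_compat; lra|apply pow_le; lra].
  - intros k Hk; unfold h; destruct (Nat.ltb_spec k n); [lia|auto].
Qed.

Lemma re_log_factor_pos (k : nat) : 0 < Re (1 + s * x ^ S k)%C.
Proof.
  apply re_1_plus_pos; eapply Rle_lt_trans; [apply (Cmod_twisted_pow_le r); auto|].
  apply pow_lt_1_compat; [auto|lia].
Qed.

Lemma Cprod_as_Cexp (n : nat) :
  Cprod (fun k => 1 + s * x ^ S k)%C n = Cexp (Csum (fun k => Clog (1 + s * x ^ S k)%C) n).
Proof.
  rewrite Cexp_Csum; apply Cprod_ext; intros k; rewrite Cexp_Clog; [auto|].
  apply re_log_factor_pos.
Qed.

End logsum_disk.

Lemma Clim_comp {T S : Type} {F : (T -> Prop) -> Prop} {G : (S -> Prop) -> Prop}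
    (u : T -> C) (phi : S -> T) (l : C) :
  filterlim phi G F -> Clim F u l -> Clim G (fun t => u (phi t)) l.
Proof.
  intros Hp [H1 H2]; split;
    [exact (filterlim_comp _ _ _ _ _ _ _ _ Hp H1)|exact (filterlim_comp _ _ _ _ _ _ _ _ Hp H2)].
Qed.

Lemma filterlim_nat_infty (phi : nat -> nat) :
  (forall M, exists N, forall n, (N <= n)%nat -> (M <= phi n)%nat) ->
  filterlim phi eventually eventually.
Proof. intros H P [M HM]; destruct (H M) as [N HN]; exists N; auto. Qed.

Lemma exp_monotone (a b : R) : a <= b -> exp a <= exp b.
Proof. intros [H| ->]; [left; apply exp_increasing; auto|lra]. Qed.

Lemma Cmod_m1_le : Cmod (RtoC (-1)) <= 1.
Proof. rewrite Cmod_R, Rabs_left; lra. Qed.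

Lemma Cmod_1_le : Cmod (RtoC 1) <= 1.
Proof. rewrite Cmod_1; lra. Qed.

Local Hint Resolve Cmod_m1_le Cmod_1_le Rle_refl : core.

Lemma qpoch_as_Cexp (x : C) (n : nat) : Cmod x < 1 ->
  qpoch x n = Cexp (Csum (fun k => Clog (1 + RtoC (-1) * x ^ S k)%C) n).
Proof.
  intros Hx; rewrite <- (Cprod_as_Cexp (Cmod x)) by auto.
  apply Cprod_ext; intros k; ring.
Qed.

(** * The triple product *)

Section triple_product_limit.

Context (q : C) (Hq : Cmod q < 1).

Let Hq2 : Cmod (q ^ 2)%C < 1.
Proof. exact (Cmod_pow_lt_1 q 1 Hq). Qed.

Let S2 (n : nat) : C := Csum (fun k => Clog (1 + RtoC (-1) * (q ^ 2) ^ S k)%C) n.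

(** In exponential form the quotient is bounded and its limit computed from partial sums of
    logarithms alone, with no separate lower estimate of the denominator. *)
Lemma central_qbinom_as_Cexp (n k : nat) :
  central_qbinom (q ^ 2) n k = Cexp (S2 (2 * n) + - S2 (n + k) + - S2 (n - k)).
Proof.
  unfold central_qbinom; rewrite !qpoch_as_Cexp by exact Hq2.
  rewrite !Cexp_add, !Cexp_opp; unfold S2; field; split; apply Cexp_neq_0.
Qed.

Lemma central_qbinom_bounded : exists B, forall n k, Cmod (central_qbinom (q ^ 2) n k) <= B.
Proof.
  set (r := Cmod (q ^ 2)%C); set (B := 2 * (2 / (1 - r) * / (1 - r))).
  assert (HS : forall n, - B <= Re (S2 n) <= B).
  { intros n; apply Rabs_le_between; eapply Rle_trans; [apply re_le_Cmod|].
    apply (Csum_Clog_bound r); unfold r; auto. }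
  exists (exp (B + B + B)); intros n k; rewrite central_qbinom_as_Cexp, Cmod_Cexp.
  apply exp_monotone; rewrite !re_plus, !re_opp.
  pose proof (HS (2 * n)%nat); pose proof (HS (n + k)%nat); pose proof (HS (n - k)%nat); lra.
Qed.

Lemma central_qbinom_lim (k : nat) :
  Clim eventually (fun n => central_qbinom (q ^ 2) n k) (Cexp (- logsum (RtoC (-1)) (q ^ 2)))%C.
Proof.
  set (E := logsum (RtoC (-1)) (q ^ 2)).
  assert (HE : Clim eventually S2 E)
    by (apply is_Cseries_Clim, (is_Cseries_logsum (Cmod (q ^ 2)%C)); auto).
  assert (HN : forall phi, filterlim phi eventually eventually ->
    Clim eventually (fun n => - S2 (phi n))%C (- E)%C).
  { intros phi Hphi; apply Clim_opp; exact (Clim_comp S2 phi E Hphi HE). }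
  eapply Clim_ext; [intros n; symmetry; apply central_qbinom_as_Cexp|].
  (* All three partial sums have the limit E, and two of them carry a minus sign. *)
  apply Clim_Cexp; replace (- E)%C with (E + - E + - E)%C by ring.
  apply Clim_plus; [apply Clim_plus|].
  - refine (Clim_comp S2 (fun n => 2 * n)%nat E _ HE).
    apply filterlim_nat_infty; intros M; exists M; lia.
  - apply HN, filterlim_nat_infty; intros M; exists M; lia.
  - apply HN, filterlim_nat_infty; intros M; exists (M + k)%nat; lia.
Qed.

Lemma is_Cseries_pow_exponents (a : nat -> nat) : (forall k, (k <= a k)%nat) ->
  is_Cseries (fun k => q ^ a k)%C (CSeries (fun k => q ^ a k)%C) /\
  (forall k, Cmod (q ^ a k)%C <= Cmod q ^ k).
Proof.
  intros Ha; pose proof (Cmod_ge_0 q).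
  assert (Hb : forall k, Cmod (q ^ a k)%C <= Cmod q ^ k).
  { intros k; rewrite Cmod_pow; replace (a k) with (k + (a k - k))%nat by (specialize (Ha k); lia).
    rewrite pow_add; rewrite <- (Rmult_1_r (Cmod q ^ k)) at 2.
    apply Rmult_le_compat_l; [apply pow_le; auto|].
    rewrite <- (pow1 (a k - k)); apply pow_incr; lra. }
  split; [|exact Hb].
  apply (CSeries_correct _ (pow (Cmod q))); [|exact Hb].
  apply ex_series_geom; rewrite Rabs_pos_eq; lra.
Qed.

(** Covers both halves of the symmetric sum: [a] gives the exponents k^2 or (k + 1)^2, [b] the
    offset from the centre, [m] the number of terms. *)
Lemma Clim_central_qbinom_sum (a b m : nat -> nat) : (forall k, (k <= a k)%nat) ->
  filterlim m eventually eventually ->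
  Clim eventually (fun n => Csum (fun k => central_qbinom (q ^ 2) n (b k) * q ^ a k)%C (m n))
    (Cexp (- logsum (RtoC (-1)) (q ^ 2)) * CSeries (fun k => q ^ a k))%C.
Proof.
  intros Ha Hm; destruct (is_Cseries_pow_exponents a Ha) as [Hs Hb].
  destruct central_qbinom_bounded as [B HB]; pose proof (Cmod_ge_0 q).
  assert (HB0 : 0 <= B) by (eapply Rle_trans; [apply Cmod_ge_0|apply (HB 0%nat 0%nat)]).
  set (e := Cexp (- logsum (RtoC (-1)) (q ^ 2))%C).
  pose (f := fun n k => if (k <? m n)%nat
    then (central_qbinom (q ^ 2) n (b k) * q ^ a k)%C else 0%C).
  assert (Hlt : forall k, eventually (fun n => (k < m n)%nat)).
  { intros k; apply Hm; exists (S k); intros n Hn; lia. }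
  (* The majorant must cover the terms at stage n, with constant B, and the limit terms, with
     constant |e|; hence the sum of both. *)
  apply (CTannery f (fun k => e * q ^ a k)%C (fun k => (B + Cmod e) * Cmod q ^ k)).
  - eexists; apply is_series_scaled_geom; lra.
  - intros n k; unfold f; pose proof (Cmod_ge_0 e); pose proof (pow_le (Cmod q) k ltac:(auto)).
    destruct (k <? m n)%nat.
    + rewrite Cmod_mult; apply Rmult_le_compat; auto using Cmod_ge_0.
      specialize (HB n (b k)); lra.
    + rewrite Cmod_0; apply Rmult_le_pos; lra.
  - intros k; rewrite Cmod_mult; pose proof (Cmod_ge_0 e).
    apply Rmult_le_compat; auto using Cmod_ge_0; lra.
  - intros k; apply (Clim_ext_loc (fun n => central_qbinom (q ^ 2) n (b k) * q ^ a k)%C).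
    + generalize (Hlt k); apply filter_imp; intros n Hn; unfold f.
      destruct (Nat.ltb_spec k (m n)); [auto|lia].
    + apply Clim_mult; [apply central_qbinom_lim|apply Clim_const].
  - intros n; rewrite (Csum_ext _ (f n)) by
      (intros k Hk; unfold f; destruct (Nat.ltb_spec k (m n)); [auto|lia]).
    apply is_Cseries_finite; intros k Hk; unfold f; destruct (Nat.ltb_spec k (m n)); [lia|auto].
  - exact (is_series_scal (K := C_AbsRing) (V := C_NormedModule) e _ _ Hs).
Qed.

Lemma Cprod_odd_even (n : nat) :
  Cprod (fun k => 1 + 1 * q ^ S k)%C (2 * n) =
  (Cprod (fun i => 1 + q ^ (2 * i + 1)) n * Cprod (fun k => 1 + 1 * (q ^ 2) ^ S k) n)%C.
Proof.
  induction n as [|n IH]; [simpl; ring|].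
  replace (2 * S n)%nat with (S (S (2 * n))) by lia; cbn [Cprod]; rewrite IH.
  rewrite <- Cpow_mult_r; replace (S (2 * n)) with (2 * n + 1)%nat by lia.
  replace (2 * S n)%nat with (S (2 * n + 1)) by lia; ring.
Qed.

(** Dividing the product of the first 2 n factors by its even-exponent part leaves the odd
    exponents; this is the origin of F(q) - F(q^2). *)
Lemma Clim_Cprod_odd :
  Clim eventually (Cprod (fun i => 1 + q ^ (2 * i + 1))%C)
    (Cexp (logsum 1 q + - logsum 1 (q ^ 2)))%C.
Proof.
  apply (Clim_ext (fun n => Cexp (Csum (fun k => Clog (1 + 1 * q ^ S k)%C) (2 * n)
    + - Csum (fun k => Clog (1 + 1 * (q ^ 2) ^ S k)%C) n)%C)).
  - intros n; rewrite Cexp_add, Cexp_opp, <- (Cprod_as_Cexp (Cmod q)), Cprod_odd_even by auto.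
    rewrite (Cprod_as_Cexp (Cmod (q ^ 2)%C)) by auto; field; apply Cexp_neq_0.
  - apply Clim_Cexp, Clim_plus; [|apply Clim_opp].
    + apply (Clim_comp (F := eventually) (Csum (fun k => Clog (1 + 1 * q ^ S k)%C))
        (fun n => 2 * n)%nat).
      * apply filterlim_nat_infty; intros M; exists M; lia.
      * apply is_Cseries_Clim, (is_Cseries_logsum (Cmod q)); auto.
    + apply is_Cseries_Clim, (is_Cseries_logsum (Cmod (q ^ 2)%C)); auto.
Qed.

Definition log_theta_product (q : C) : C :=
  (logsum (RtoC (-1)) (q ^ 2) + 2 * (logsum 1 q + - logsum 1 (q ^ 2)))%C.

Lemma triple_product :
  (CSeries (fun k => q ^ (k * k)) + CSeries (fun k => q ^ (S k * S k)))%C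
  = Cexp (log_theta_product q).
Proof.
  set (A := CSeries (fun k => q ^ (k * k))%C); set (B := CSeries (fun k => q ^ (S k * S k))%C).
  set (E := logsum (RtoC (-1)) (q ^ 2)); set (O := (logsum 1 q + - logsum 1 (q ^ 2))%C).
  (* The two sides of the finite identity pass to the limit separately; multiplication by [Cexp E]
     then isolates the theta series. *)
  assert (H : (Cexp O * Cexp O)%C = (Cexp (- E) * A + Cexp (- E) * B)%C).
  { refine (Clim_unique (F := eventually) _ _ _
      (Clim_mult _ _ _ _ Clim_Cprod_odd Clim_Cprod_odd) _).
    eapply Clim_ext; [intros n; symmetry; apply (finite_triple_product_sym q n Hq)|].
    apply Clim_plus.
    - apply (Clim_central_qbinom_sum (fun k => k * k)%nat (fun k => k) S);
        [intros k; nia|apply filterlim_nat_infty; intros M; exists M; lia].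
    - apply (Clim_central_qbinom_sum (fun k => S k * S k)%nat S (fun n => n));
        [intros k; nia|apply filterlim_nat_infty; intros M; exists M; lia]. }
  unfold log_theta_product; fold E O; replace (2 * O)%C with (O + O)%C by ring.
  rewrite !Cexp_add, H, Cexp_opp; field; apply Cexp_neq_0.
Qed.

End triple_product_limit.

(** * The nome, and theta3 as an exponential *)

Definition nome (tau : C) : C := Cexp (Ci * PI * tau)%C.

Lemma Re_nome_exponent (tau : C) : Re (Ci * PI * tau)%C = - PI * Im tau.
Proof. destruct tau; simpl; ring. Qed.

Lemma Cmod_nome (tau : C) : Cmod (nome tau) = exp (- PI * Im tau).
Proof. unfold nome; rewrite Cmod_Cexp, Re_nome_exponent; auto. Qed.

Lemma Cmod_nome_lt_1 (tau : C) : 0 < Im tau -> Cmod (nome tau) < 1.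
Proof.
  intros H; rewrite Cmod_nome, <- exp_0; apply exp_increasing; pose proof PI_RGT_0; nra.
Qed.

Lemma nome_nat_mul (n : nat) (tau : C) : nome (INR n * tau) = (nome tau ^ n)%C.
Proof. unfold nome; rewrite <- Cexp_nat_mul; f_equal; ring. Qed.

Lemma theta3_product (tau : C) : 0 < Im tau ->
  theta3 tau = Cexp (log_theta_product (nome tau)).
Proof.
  intros H; rewrite <- triple_product by (apply Cmod_nome_lt_1; auto).
  assert (E : forall (k : Z) (n : nat), (k * k = Z.of_nat (n * n))%Z ->
    Cexp (Ci * PI * tau * IZR (k * k)%Z)%C = (nome tau ^ (n * n))%C).
  { intros k n ->; rewrite <- nome_nat_mul, INR_IZR_INZ; unfold nome; f_equal; ring. }
  unfold theta3, CZSeries; f_equal; unfold CSeries; f_equal; apply Series_ext; intros n;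
    f_equal; apply E; lia.
Qed.

Lemma log_factor_pos (s x : C) (k : nat) : Cmod s <= 1 -> Cmod x < 1 ->
  0 < Re (1 + s * x ^ S k)%C.
Proof. intros Hs Hx; apply (re_log_factor_pos (Cmod x)); auto. Qed.

(** Termwise (1 - x^k)(1 + x^k) = 1 - x^(2k); both factors and the product lie in the right
    half-plane, so [Clog] adds without a multiple of 2 PI. *)
Lemma logsum_add (x : C) : Cmod x < 1 ->
  (logsum (RtoC (-1)) x + logsum 1 x)%C = logsum (RtoC (-1)) (x ^ 2).
Proof.
  intros Hx; pose proof (Cmod_pow_lt_1 x 1 Hx).
  symmetry; apply is_Cseries_unique.
  apply (is_Cseries_ext
    (fun k => Clog (1 + RtoC (-1) * x ^ S k)%C + Clog (1 + 1 * x ^ S k)%C)%C).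
  - intros k.
    assert (E : (1 + RtoC (-1) * (x ^ 2) ^ S k)%C =
      ((1 + RtoC (-1) * x ^ S k) * (1 + 1 * x ^ S k))%C).
    { rewrite <- Cpow_mult_r; replace (2 * S k)%nat with (S k + S k)%nat by lia.
      rewrite Cpow_add_r; ring. }
    rewrite E, Clog_mult; auto using log_factor_pos.
    rewrite <- E; apply log_factor_pos; auto.
  - apply is_Cseries_plus; apply (is_Cseries_logsum (Cmod x)); auto.
Qed.

(** * The branch of log theta3 *)

Lemma logsum_real (s x : R) : Rabs s <= 1 -> Rabs x < 1 -> Im (logsum s x) = 0.
Proof.
  intros Hs Hx; unfold logsum, CSeries; simpl Im.
  (* Writing the zero term as [0 * 0] lets [Series_scal_l] evaluate the sum. *)
  rewrite (Series_ext _ (fun k => 0 * 0)); [rewrite Series_scal_l; ring|].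
  intros k; assert (Hp : 0 < Re (1 + s * x ^ S k)%C)
    by (apply log_factor_pos; rewrite Cmod_R; auto).
  change (Carg (1 + s * x ^ S k)%C = 0 * 0); rewrite Carg_atan by auto.
  replace (Im (1 + s * x ^ S k)%C) with 0.
  - rewrite Rdiv_0_l, atan_0; ring.
  - rewrite <- RtoC_pow, <- RtoC_mult, <- RtoC_plus; reflexivity.
Qed.

Lemma log_theta_product_real (x : R) : Rabs x < 1 -> Im (log_theta_product x) = 0.
Proof.
  intros Hx; assert (Hx2 : Rabs (x ^ 2) < 1)
    by (rewrite <- RPow_abs; apply pow_lt_1_compat; [split; [apply Rabs_pos|auto]|lia]).
  unfold log_theta_product; rewrite <- RtoC_pow.
  assert (H1 : Rabs 1 <= 1) by (rewrite Rabs_R1; lra).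
  assert (Hm : Rabs (-1) <= 1) by (rewrite Rabs_left; lra).
  pose proof (logsum_real _ _ H1 Hx); pose proof (logsum_real _ _ H1 Hx2);
    pose proof (logsum_real _ _ Hm Hx2).
  rewrite im_plus, im_mult, im_plus, im_opp; simpl (Im 2%C); simpl (Re 2%C).
  rewrite H, H0, H2; ring.
Qed.

Lemma Clim_Clog {T : Type} {F : (T -> Prop) -> Prop} {FF : ProperFilter F} (f : T -> C) (a : C) :
  (forall t, 0 < Re (f t)) -> 0 < Re a -> Clim F f a ->
  Clim F (fun t => Clog (f t)) (Clog a).
Proof.
  intros Hf Ha [H1 H2]; split.
  - simpl; apply filterlim_continuous; [|apply continuous_ln, Cmod_pos_of_re; auto].
    unfold Cmod; apply filterlim_continuous; [|apply continuous_sqrt].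
    simpl; apply filterlim_Rplus; repeat apply filterlim_Rmult; auto; apply filterlim_const.
  - simpl; rewrite Carg_atan by auto.
    eapply filterlim_ext; [intros t; symmetry; apply Carg_atan; auto|].
    apply filterlim_continuous; [|apply continuous_atan].
    apply filterlim_Rmult; [auto|].
    apply (filterlim_continuous _ Rinv); [auto|apply continuous_Rinv; lra].
Qed.

Lemma Clim_pow {T : Type} {F : (T -> Prop) -> Prop} {FF : ProperFilter F}
    (f : T -> C) (a : C) (n : nat) : Clim F f a -> Clim F (fun t => f t ^ n)%C (a ^ n)%C.
Proof.
  intros H; induction n as [|n IH]; [apply Clim_const|].
  exact (Clim_mult _ _ _ _ H IH).
Qed.

(** Dominated convergence in the argument: the radius r < 1 common to all t supplies one geometric
    majorant. *)
Lemma Clim_logsum {T : Type} {F : (T -> Prop) -> Prop} {FF : ProperFilter F}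
    (r : R) (s : C) (f : T -> C) (a : C) :
  r < 1 -> Cmod s <= 1 -> (forall t, Cmod (f t) <= r) -> Cmod a <= r -> Clim F f a ->
  Clim F (fun t => logsum s (f t)) (logsum s a).
Proof.
  intros Hr Hs Hf Ha H; pose proof (Cmod_ge_0 a).
  apply (CTannery (fun t k => Clog (1 + s * f t ^ S k)%C) (fun k => Clog (1 + s * a ^ S k)%C)
    (fun k => 2 / (1 - r) * r ^ k)).
  - eexists; apply is_series_scaled_geom; lra.
  - intros t k; apply Clog_term_bound; auto.
  - intros k; apply Clog_term_bound; auto.
  - intros k; apply Clim_Clog.
    + intros t; apply (re_log_factor_pos r); auto.
    + apply (re_log_factor_pos r); auto.
    + apply Clim_plus; [apply Clim_const|apply Clim_mult; [apply Clim_const|]].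
      apply Clim_pow; auto.
  - intros t; apply (is_Cseries_logsum r); auto.
  - apply (is_Cseries_logsum r); auto.
Qed.

Lemma Clim_log_theta_product {T : Type} {F : (T -> Prop) -> Prop} {FF : ProperFilter F}
    (r : R) (f : T -> C) (a : C) :
  r < 1 -> (forall t, Cmod (f t) <= r) -> Cmod a <= r -> Clim F f a ->
  Clim F (fun t => log_theta_product (f t)) (log_theta_product a).
Proof.
  intros Hr Hf Ha H; pose proof (Cmod_ge_0 a).
  assert (Hsq : forall z, Cmod z <= r -> Cmod (z ^ 2)%C <= r).
  { intros z Hz; rewrite Cmod_pow; pose proof (Cmod_ge_0 z); simpl; nra. }
  unfold log_theta_product; apply Clim_plus; [|apply Clim_mult; [apply Clim_const|apply Clim_plus]].
  - apply (Clim_logsum r); auto using Clim_pow.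
  - apply (Clim_logsum r); auto.
  - apply Clim_opp, (Clim_logsum r); auto using Clim_pow.
Qed.

(** Differentiability speaks of neighbourhoods for the modulus, [Clim] of those of the product
    structure; [locally_C] identifies them. *)
Lemma ex_derive_Clim (L : C -> C) (z : C) :
  @ex_derive C_AbsRing C_NormedModule L z -> Clim (@locally C_UniformSpace z) L (L z).
Proof.
  intros H; apply Clim_filterlim.
  apply (ex_derive_continuous (K := C_AbsRing) (V := C_NormedModule)) in H.
  intros P HP; apply locally_C; exact (H P HP).
Qed.

(** A nonzero multiple of 2 PI at 1 would force the intermediate value PI or - PI, which is no
    integer multiple of 2 PI. *)
Lemma continuous_2PIZ (h : R -> R) :
  continuity h -> (forall t, exists k : Z, h t = 2 * IZR k * PI) -> h 0 = 0 -> h 1 = 0.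
Proof.
  intros Hc Hk H0; destruct (Hk 1) as [k Hk1]; pose proof PI_RGT_0.
  assert (Hodd : forall x, h x <> PI /\ h x <> - PI).
  { intros x; destruct (Hk x) as [j ->]; split; intros E.
    - assert (E' : IZR (2 * j) = IZR 1) by (rewrite mult_IZR; nra).
      apply eq_IZR in E'; lia.
    - assert (E' : IZR (2 * j) = IZR (-1)) by (rewrite mult_IZR; nra).
      apply eq_IZR in E'; lia. }
  destruct (Z.lt_trichotomy k 0) as [Hn|[->|Hp]].
  - assert (IZR k <= -1) by (apply IZR_le; lia).
    destruct (IVT_gen h 0 1 (- PI) Hc) as [x [_ Hx]].
    + rewrite H0, Hk1, Rmin_right, Rmax_left by nra; nra.
    + destruct (Hodd x); tauto.
  - rewrite Hk1; ring.
  - assert (1 <= IZR k) by (apply IZR_le; lia).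
    destruct (IVT_gen h 0 1 PI Hc) as [x [_ Hx]].
    + rewrite H0, Hk1, Rmin_left, Rmax_right by nra; nra.
    + destruct (Hodd x); tauto.
Qed.

(* Both sides are logarithms of theta3; they agree on the imaginary axis, and their
   difference is constant along the horizontal segment from [Ci * Im tau] to [tau],
   on which the nome has constant modulus. *)
Lemma logtheta3_eq_product (L : C -> C) (tau : C) : is_log_theta3 L -> 0 < Im tau ->
  L tau = log_theta_product (nome tau).
Proof.
  intros [Hd [He Hi]] Htau.
  assert (HE : forall z, 0 < Im z -> Cexp (L z) = Cexp (log_theta_product (nome z)))
    by (intros z Hz; rewrite He, theta3_product; auto).
  pose (path := fun t : R => ((t * Re tau, Im tau) : C)).
  assert (Hpath : forall t0, Clim (locally t0) path (path t0)).
  { intros t0; split; simpl; [|apply filterlim_const].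
    apply filterlim_Rmult; [apply filterlim_id|apply filterlim_const]. }
  assert (Hr : exp (- PI * Im tau) < 1)
    by (rewrite <- (Cmod_nome tau); apply Cmod_nome_lt_1; auto).
  pose (h := fun t => Im (L (path t) + - log_theta_product (nome (path t)))%C).
  assert (Hh : h 1 = 0).
  { apply continuous_2PIZ.
    - intros t0; apply continuity_pt_filterlim; unfold h.
      refine (proj2 (Clim_plus (F := locally t0) (fun t => L (path t))
        (fun t => - log_theta_product (nome (path t)))%C _ _ _ _)).
      + apply (Clim_comp (F := @locally C_UniformSpace (path t0)) L path).
        * apply Clim_filterlim, Hpath.
        * apply ex_derive_Clim, Hd; auto.
      + apply Clim_opp, (Clim_log_theta_product (exp (- PI * Im tau))); auto.
        * intros t; rewrite Cmod_nome; apply Rle_refl.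
        * rewrite Cmod_nome; apply Rle_refl.
        * unfold nome; apply Clim_Cexp, Clim_mult; [apply Clim_const|apply Hpath].
    - intros t; destruct (Cexp_eq _ _ (HE (path t) Htau)) as [_ [k Hk]].
      exists k; unfold h; rewrite im_plus, im_opp, Hk; ring.
    (* On the imaginary axis the nome is a real number in (0, 1), so both logarithms are real
       there. *)
    - assert (E0 : path 0 = (Ci * Im tau)%C) by (apply C_eq; simpl; ring).
      unfold h; rewrite E0, Hi by auto.
      replace (nome (Ci * Im tau)%C) with (RtoC (exp (- PI * Im tau))).
      + rewrite im_plus, im_opp, log_theta_product_real
          by (rewrite Rabs_pos_eq; [auto|left; apply exp_pos]).
        simpl (Im (RtoC (ln _))); ring.
      + unfold nome, Cexp; replace (Im (Ci * PI * (Ci * Im tau))%C) with 0 by (simpl; ring).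
        rewrite Re_nome_exponent, cos_0, sin_0; apply C_eq; simpl; [|ring].
        rewrite Rmult_1_r; f_equal; ring. }
  assert (E1 : path 1 = tau) by (apply C_eq; simpl; ring).
  unfold h in Hh; rewrite E1, im_plus, im_opp in Hh.
  (* Equal exponentials already settle the real parts; only the imaginary part needed the path. *)
  apply C_eq; [apply (Cexp_eq _ _ (HE tau Htau))|lra].
Qed.

(** * Telescoping *)

(** The function G of the overview; at x = q^2 it is the right-hand side of the theorem. *)
Definition log_weight (x : C) : C := (2 * logsum (RtoC (-1)) x + 4 * logsum 1 x)%C.

Lemma log_theta_product_telescope (x : C) : Cmod x < 1 ->
  log_theta_product x = (log_weight x + - (/ 2) * log_weight (x ^ 2))%C.
Proof.
  intros H; unfold log_theta_product, log_weight; rewrite <- logsum_add by auto.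
  field; intros E; injection E; lra.
Qed.

Lemma log_weight_bound (r : R) : r < 1 ->
  exists B, 0 <= B /\ forall x, Cmod x <= r -> Cmod (log_weight x) <= B.
Proof.
  intros Hr; set (b := 2 * (2 / (1 - r) * / (1 - r))).
  assert (Hi : 0 < / (1 - r)) by (apply Rinv_0_lt_compat; lra).
  assert (Hb : 0 <= b) by (unfold b, Rdiv; nra).
  (* The 6 is 2 + 4, the sum of the coefficients of the two [logsum] terms. *)
  exists (6 * b); split; [lra|].
  intros x Hx; unfold log_weight; eapply Rle_trans; [apply Cmod_triangle|].
  rewrite !Cmod_mult, !Cmod_R, !Rabs_pos_eq by lra.
  assert (Cmod (logsum (RtoC (-1)) x) <= b) by (apply logsum_bound; auto).
  assert (Cmod (logsum 1 x) <= b) by (apply logsum_bound; auto); lra.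
Qed.

Lemma Clim_0_of_geometric (u : nat -> C) (B : R) :
  (forall n, Cmod (u n) <= B * (1 / 2) ^ n) -> Clim eventually u 0.
Proof.
  intros H.
  assert (HB : is_lim_seq (fun n => B * (1 / 2) ^ n) 0).
  { replace (Finite 0) with (Rbar_mult B 0) by (simpl; f_equal; ring).
    apply is_lim_seq_scal_l, is_lim_seq_geom; rewrite Rabs_pos_eq; lra. }
  assert (Hv : forall v : nat -> R, (forall n, Rabs (v n) <= B * (1 / 2) ^ n) -> is_lim_seq v 0).
  { intros v Hv; apply is_lim_seq_abs_0.
    apply (is_lim_seq_le_le (fun _ => 0) _ (fun n => B * (1 / 2) ^ n));
      [intros n; split; [apply Rabs_pos|auto]|apply is_lim_seq_const|exact HB]. }
  split; apply Hv; intros n; eapply Rle_trans; [apply re_le_Cmod|auto|apply im_le_Cmod|auto].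
Qed.

Lemma pow_of_pow_2_le (r : R) (x : C) (n : nat) : Cmod x <= r -> r < 1 ->
  Cmod (x ^ (2 ^ n))%C <= r.
Proof.
  intros Hx Hr; rewrite Cmod_pow; pose proof (Cmod_ge_0 x).
  assert (Hn : exists d, (2 ^ n = S d)%nat)
    by (pose proof (Nat.pow_nonzero 2 n); exists (2 ^ n - 1)%nat; lia).
  destruct Hn as [d ->]; simpl.
  assert (Cmod x ^ d <= 1) by (rewrite <- (pow1 d); apply pow_incr; lra).
  pose proof (pow_le (Cmod x) d ltac:(auto)); nra.
Qed.

Lemma Csum_log_theta_product (x : C) (n : nat) : Cmod x < 1 ->
  Csum (fun j => RtoC ((1 / 2) ^ j) * log_theta_product (x ^ (2 ^ j)))%C n =
  (log_weight x + - (RtoC ((1 / 2) ^ n) * log_weight (x ^ (2 ^ n))))%C.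
Proof.
  intros H; induction n as [|n IH].
  - cbn [Csum]; simpl; rewrite Cmult_1_r, Cmult_1_l; ring.
  - cbn [Csum]; rewrite IH, log_theta_product_telescope
      by (eapply Rle_lt_trans; [apply (pow_of_pow_2_le (Cmod x)); auto|auto]).
    rewrite <- Cpow_mult_r; replace (2 ^ n * 2)%nat with (2 ^ S n)%nat by (simpl; lia).
    replace (RtoC ((1 / 2) ^ S n)) with (/ 2 * RtoC ((1 / 2) ^ n))%C.
    + field; intros E; injection E; lra.
    + rewrite <- RtoC_inv, <- RtoC_mult by lra; f_equal; simpl; field.
Qed.

Theorem lemma2 :
  forall (logtheta3 : C -> C), is_log_theta3 logtheta3 ->
  forall (tau q : C), 0 < Im tau -> q = Cexp (Ci * PI * tau)%C ->
  let lhs (m : nat) : C := (2 / 2 ^ m * logtheta3 (2 ^ m * tau))%C in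
  ex_series (fun n : nat => Cmod (lhs (S n))) /\
  exists A B : C,
    is_Cseries (fun n : nat => Clog (1 - q ^ (2 * S n))%C) A /\
    is_Cseries (fun n : nat => Clog (1 + q ^ (2 * S n))%C) B /\
    is_Cseries (fun n : nat => lhs (S n)) (2 * A + 4 * B)%C.
Proof.
  intros L HL tau q Htau Hq lhs; change (Cexp (Ci * PI * tau)%C) with (nome tau) in Hq.
  assert (Hq1 : Cmod q < 1) by (subst q; apply Cmod_nome_lt_1; auto).
  pose proof (Cmod_pow_lt_1 q 1 Hq1) as Hx; set (x := (q ^ 2)%C) in *.
  (* The index m = n + 1 gives the weight 2 / 2^(n+1) = (1/2)^n and the nome q^(2^(n+1)) = x^(2^n),
     so the sum over m >= 1 is the telescoping series in x = q^2 from exponent 0. *)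
  assert (Elhs : forall n, lhs (S n) = (RtoC ((1 / 2) ^ n) * log_theta_product (x ^ (2 ^ n)))%C).
  { intros n; unfold lhs.
    assert (E2 : (2 ^ S n)%C = RtoC (INR (2 ^ S n)))
      by (rewrite <- RtoC_pow, pow_INR; reflexivity).
    assert (Hpos : 0 < INR (2 ^ S n))
      by (apply lt_0_INR, Nat.neq_0_lt_0, Nat.pow_nonzero; lia).
    rewrite (logtheta3_eq_product L) by
      (auto; rewrite E2, im_scal_l; apply Rmult_lt_0_compat; auto).
    f_equal.
    - rewrite <- RtoC_pow, <- RtoC_div by (apply pow_nonzero; lra); f_equal.
      unfold Rdiv at 2; rewrite Rmult_1_l, pow_inv; simpl; field; apply pow_nonzero; lra.
    - f_equal; rewrite E2, nome_nat_mul, <- Hq; unfold x; rewrite <- Cpow_mult_r; reflexivity. }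
  destruct (log_weight_bound (Cmod x) Hx) as [B [HB0 HB]].
  assert (HBn : forall n, Cmod (log_weight (x ^ (2 ^ n))) <= B)
    by (intros n; apply HB, pow_of_pow_2_le; auto).
  assert (Hhalf : forall n, 0 <= (1 / 2) ^ n) by (intros n; apply pow_le; lra).
  split.
  (* By the telescoping identity each value of P is at most B + B / 2 in modulus, hence below 2
     B. *)
  - apply (ex_series_le (K := R_AbsRing) (V := R_CompleteNormedModule) _
      (fun n => 2 * B * (1 / 2) ^ n)); [|eexists; apply is_series_scaled_geom; lra].
    intros n; unfold norm; simpl; unfold abs; simpl.
    rewrite Rabs_pos_eq by apply Cmod_ge_0.
    rewrite Elhs, Cmod_mult, Cmod_R, Rabs_pos_eq, Rmult_comm by auto.
    apply Rmult_le_compat_r; [auto|].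
    rewrite log_theta_product_telescope
      by (eapply Rle_lt_trans; [apply (pow_of_pow_2_le (Cmod x)); auto|auto]).
    eapply Rle_trans; [apply Cmod_triangle|].
    rewrite Cmod_mult, Cmod_opp, <- RtoC_inv, Cmod_R, Rabs_pos_eq by lra.
    rewrite <- Cpow_mult_r; replace (2 ^ n * 2)%nat with (2 ^ S n)%nat by (simpl; lia).
    pose proof (HBn n); pose proof (HBn (S n)); lra.
  - exists (logsum (RtoC (-1)) x), (logsum 1 x); repeat split.
    + apply (is_Cseries_ext (fun k => Clog (1 + RtoC (-1) * x ^ S k)%C)).
      * intros k; f_equal; unfold x; rewrite Cpow_mult_r; ring.
      * apply (is_Cseries_logsum (Cmod x)); auto.
    + apply (is_Cseries_ext (fun k => Clog (1 + 1 * x ^ S k)%C)).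
      * intros k; f_equal; unfold x; rewrite Cpow_mult_r; ring.
      * apply (is_Cseries_logsum (Cmod x)); auto.
    (* The partial sums are G(x) minus a remainder of modulus at most B (1/2)^n. *)
    + apply (is_Cseries_ext _ _ _ (fun n => eq_sym (Elhs n))), is_Cseries_Clim.
      eapply Clim_ext; [intros n; symmetry; apply Csum_log_theta_product; auto|].
      replace (2 * logsum (RtoC (-1)) x + 4 * logsum 1 x)%C with (log_weight x + 0)%C
        by (unfold log_weight; ring).
      apply Clim_plus; [apply Clim_const|].
      apply (Clim_0_of_geometric _ B); intros n.
      rewrite Cmod_opp, Cmod_mult, Cmod_R, Rabs_pos_eq, Rmult_comm by auto.
      apply Rmult_le_compat_r; auto.
Qed.
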